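(* Let $m\geq 57$ be an integer and let $G$ be a $\theta_{2,2,3}$-free graph with exactly $m$ edges and no isolated vertices. Then $\lambda(G)\leq\frac{1+\sqrt{4m-3}}{2}$, and equality holds if and only if $G\cong K_2\vee\frac{m-1}{2}K_1$.
   Context: All graphs are finite, simple and undirected. For integers $q\geq p\geq r\geq 1$ with $p\geq 2$, the theta graph $\theta_{r,p,q}$ is the graph obtained by joining two distinct vertices by three internally disjoint paths of lengths $r,p,q$. A graph is $F$-free if it contains no subgraph isomorphic to $F$. $\lambda(G)$ denotes the spectral radius (largest eigenvalue of the adjacency matrix) of $G$. For graphs $G,H$, $G\vee H$ is the join, obtained from the disjoint union by adding all edges between $V(G)$ and $V(H)$; $tK_1$ denotes the edgeless graph on $t$ vertices, and $K_2$ is a single edge. (So $K_2\vee\frac{m-1}{2}K_1$ is defined when $m$ is odd.) *)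

(* Defs.v *)
From HB Require Import structures.
From mathcomp Require Import all_boot all_order all_algebra.
From mathcomp Require Import complex polyrcf.
From mathcomp Require Import boolp classical_sets reals.

Set Implicit Arguments.
Unset Strict Implicit.
Unset Printing Implicit Defensive.

Import Order.TTheory GRing.Theory Num.Theory.
Local Open Scope ring_scope.

Record sgraph := SGraph {
  vertex :> finType;
  adj : rel vertex;
  adj_sym : symmetric adj;
  adj_irrefl : irreflexive adj
}.

Definition edges (G : sgraph) : {set {set G}} :=
  [set [set z.1; z.2]%SET | z in [pred z : G * G | adj z.1 z.2]]%SET.

Definition no_isolated_vertex (G : sgraph) : Prop :=
  forall x : G, exists y : G, adj x y.

(* F occurs as a (not necessarily induced) subgraph of G. *)
Definition contains_subgraph (F G : sgraph) : Prop :=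
  exists2 f : F -> G, injective f & forall x y, adj x y -> adj (f x) (f y).

Definition free_of (F G : sgraph) : Prop := ~ contains_subgraph F G.

Definition isomorphic (G H : sgraph) : Prop :=
  exists2 f : G -> H, bijective f & forall x y, adj (f x) (f y) = adj x y.

Section SymClosure.
Variables (T : finType) (r : rel T).
Definition sym_adj : rel T := [rel x y | (x != y) && (r x y || r y x)].
Fact sym_adj_sym : symmetric sym_adj.
Proof. by move=> x y; rewrite /sym_adj /= eq_sym orbC. Qed.
Fact sym_adj_irrefl : irreflexive sym_adj.
Proof. by move=> x; rewrite /sym_adj /= eqxx. Qed.
Definition sym_graph : sgraph := SGraph sym_adj_sym sym_adj_irrefl.
End SymClosure.

Definition complete_graph (n : nat) : sgraph :=
  @sym_graph 'I_n (fun _ _ => true).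

Definition edgeless_graph (n : nat) : sgraph :=
  @sym_graph 'I_n (fun _ _ => false).

Section Join.
Variables G H : sgraph.
Definition join_adj : rel (G + H)%type := fun x y =>
  match x, y with
  | inl a, inl b => adj a b
  | inr a, inr b => adj a b
  | _, _ => true
  end.
Fact join_adj_sym : symmetric join_adj.
Proof. by move=> [a|a] [b|b] //=; rewrite adj_sym. Qed.
Fact join_adj_irrefl : irreflexive join_adj.
Proof. by move=> [a|a] /=; rewrite adj_irrefl. Qed.
Definition graph_join : sgraph := SGraph join_adj_sym join_adj_irrefl.
End Join.

(* The j-th vertex (0 <= j <= l) of a path of length l joining the end
   vertices 0 and 1, whose inner vertices are o + 1, ..., o + l - 1. *)
Definition path_vertex (o l j : nat) : nat :=
  if j == 0%N then 0%N else if j == l then 1%N else (o + j)%N.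

Definition path_step (o l : nat) (x y : nat) : bool :=
  [exists j : 'I_l, (x == path_vertex o l j) && (y == path_vertex o l j.+1)].

(* The three paths have inner vertices 2, ..., r; then r + 1, ..., r + p - 1;
   then r + p, ..., r + p + q - 2.  Meaningful for 1 <= r <= p <= q, 2 <= p. *)
Definition theta_graph (r p q : nat) : sgraph :=
  @sym_graph 'I_(r + p + q).-1 (fun x y =>
    [|| path_step 1 r x y, path_step r p x y | path_step (r + p).-1 q x y]).

Definition adjmx (R : realType) (G : sgraph) : 'M[R]_#|G| :=
  \matrix_(i, j) (adj (enum_val i) (enum_val j))%:R.

(* The set of eigenvalues is finite, and nonempty as soon as G has a vertex,
   so that this supremum is a maximum: see spectral_radiusP. *)
Definition spectral_radius (R : realType) (G : sgraph) : R :=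
  sup [set x : R | eigenvalue (adjmx R G) x]%classic.

Lemma adjmx_has_eigenvalue (R : realType) (G : sgraph) :
  (0 < #|G|)%N -> exists x : R, eigenvalue (adjmx R G) x.
Proof.
move=> G0; set A := adjmx R G.
pose B := map_mx (real_complex R) A.
have Bsym : B \is hermsymmx.
  apply: realsym_hermsym.
    apply/is_hermitianmxP; rewrite expr0 scale1r; apply/matrixP => i j.
    by rewrite !mxE adj_sym.
  by apply/mxOverP => i j; rewrite !mxE; apply/complex_realP; eexists.
have /orthomx_spectralP BE := hermitian_normalmx Bsym.
set P := spectralmx B in BE; set D := spectral_diag B in BE.
have Pu : P \in unitmx by apply: spectral_unit.
pose i := Ordinal G0.
have /mxOverP /(_ 0 i) /complex_realP [x xE] := hermitian_spectral_diag_real Bsym.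
exists x; rewrite eigenvalue_root_char -(fmorph_root (real_complex R)).
rewrite map_char_poly -eigenvalue_root_char; apply/eigenvalueP.
exists (row i P); last first.
  by apply: contraTneq Pu => Pi0; rewrite -row_free_unit -kermx_eq0;
    apply/rowV0Pn; exists (delta_mx 0 i); [apply/sub_kermxP; rewrite -rowE
      | apply/negP => /eqP /matrixP /(_ 0 i) /eqP; rewrite !mxE !eqxx oner_eq0].
rewrite -/A -/B [in LHS]BE -row_mul -!mulmxA mulKVmx //.
by rewrite mul_diag_mx; apply/rowP => j; rewrite !mxE xE.
Qed.

Lemma spectral_radiusP (R : realType) (G : sgraph) : (0 < #|G|)%N ->
  eigenvalue (adjmx R G) (spectral_radius R G) /\
  forall x, eigenvalue (adjmx R G) x -> x <= spectral_radius R G.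
Proof.
move=> /(@adjmx_has_eigenvalue R) [a ea]; set A := adjmx R G.
pose s := rootsR (char_poly A).
have sE x : (x \in s) = eigenvalue A x.
  rewrite eigenvalue_root_char.
  have := roots_on_rootsR (monic_neq0 (char_poly_monic A)) x.
  by rewrite in_itv /=.
pose M := \big[Num.max/a]_(x <- s) x.
have Mub x : eigenvalue A x -> x <= M.
  by rewrite -sE => xs; apply: (@le_bigmax_seq _ _ _ s a x xpredT id).
have eM : eigenvalue A M.
  rewrite /M big_seq; apply: (big_ind (eigenvalue A)) => //; last by move=> x; rewrite sE.
  by move=> x y ex ey; rewrite /Num.max; case: ifP.
suff -> : spectral_radius R G = M by [].
apply/eqP; rewrite eq_le; apply/andP; split.
  by apply: ge_sup; [exists a | exact: Mub].
by apply: ub_le_sup => //; exists M.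
Qed.

(* Main.v *)
Require Import Defs.
From mathcomp Require Import all_boot all_order all_algebra.
From mathcomp Require Import zify ring lra reals.
Import Order.TTheory GRing.Theory Num.Theory.
Local Open Scope ring_scope.

(* Let l >= 8 be the spectral radius and z the vector of absolute values of an
   eigenvector, scaled so that its maximal entry is z u = 1.  Then A z >= l z
   entrywise, which is all that is needed of z.  Put N := N(u), let W be the
   set of the vertices outside N and u, and let d v be the number of neighbours
   of v in N.  Counting walks of length 2 from u and comparing with the
   decomposition of the edges along N and W, the inequality l^2 - l >= m - 1
   becomes
     sum_N (d/2 - (d - 1) z) + sum_W d (1 - z) + e(W) <= 1.
   Theta-freeness says that, if t <> u has at least 4 neighbours in N, then no
   neighbour of t in N has a neighbour in N other than t.  Hence N splits into big stars (d >= 4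
   at the centre, 1 at the leaves) and a remainder C where d <= 3, and the
   vertices of W adjacent to an edge inside C have d <= 3.  Since l >= 8, the
   entries of z on C and on those vertices are so small that C contributes at
   least sum_C z; a big star contributes at least 1.  If there is no big star,
   then sum_N z >= l contradicts the inequality; otherwise there is exactly one,
   every inequality is tight, and C and W are empty. *)

Set Implicit Arguments.
Unset Strict Implicit.
Unset Printing Implicit Defensive.

(** * Theta subgraphs, edge counting and eigenvectors *)

Lemma theta223_free_path (G : sgraph) (s t a b c e : G) :
  free_of (theta_graph 2 2 3) G -> uniq [:: s; t; a; b; c; e] ->
  adj s a -> adj a t -> adj s b -> adj b t ->
  adj s c -> adj c e -> adj e t -> False.
Proof.
move=> free us sa at_ sb bt sc ce et; apply: free.
(* The list follows the numbering of [theta_graph 2 2 3]: ends 0 and 1, then inner vertex 2 of the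
   first path, 3 of the second, and 4, 5 of the path of length 3. *)
pose f (i : theta_graph 2 2 3) := nth s [:: s; t; a; b; c; e] (i : 'I_6).
exists f.
  by move=> i j /eqP; rewrite /f nth_uniq ?ltn_ord // => /eqP/val_inj.
suff H (i j : 'I_6) : [|| path_step 1 2 i j, path_step 2 2 i j
    | path_step 3 3 i j] -> adj (f i) (f j).
  move=> i j; change (sym_adj (fun x y : 'I_6 => [|| path_step 1 2 x y,
    path_step 2 2 x y | path_step 3 3 x y]) i j -> adj (f i) (f j)).
  by case/andP=> _ /orP[/H//|/H]; rewrite adj_sym.
rewrite /f; case/or3P => /existsP[[k lk]] /andP[/eqP-> /eqP->];
  by case: k lk => [|[|[|k]]].
Qed.

(** Group the ordered adjacent pairs by their underlying set [h]: the fibre over an edge {a, b} is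
    (a, b) and (b, a), distinct because [adj] is irreflexive. *)
Lemma sum_adj_edges (G : sgraph) :
  (\sum_(x : G) \sum_(y : G) adj x y)%N = (#|edges G|.*2)%N.
Proof.
pose P := [set z : G * G | adj z.1 z.2].
have -> : (\sum_(x : G) \sum_(y : G) adj x y)%N = #|P|.
  rewrite pair_big /= -sum1_card big_mkcond /= [RHS]big_mkcond /=.
  by apply: eq_bigr => z _; rewrite inE; case: adj.
pose h (z : G * G) := [set z.1; z.2].
have hE : edges G = h @: P by apply/setP=> E; apply/imsetP/imsetP => -[z zP ->];
  exists z => //; move: zP; rewrite !inE.
rewrite -sum1_card (partition_big_imset h) -hE /= -mul2n mulnC -sum_nat_const.
apply: eq_bigr => E; rewrite hE => /imsetP[[a b]]; rewrite inE /= => ab ->.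
rewrite sum1dep_card.
have nab : a != b by apply: contraTneq ab => ->; rewrite adj_irrefl.
suff -> : [set z in P | h z == h (a, b)] = [set (a, b); (b, a)].
  by rewrite cards2 xpair_eqE negb_and nab.
apply/setP => -[x y]; rewrite !inE /= !xpair_eqE.
apply/andP/orP => [[xy /eqP/setP hxy]|[]/andP[/eqP-> /eqP->]]; last 2 first.
- by rewrite ab eqxx.
- by rewrite adj_sym ab /h /= setUC eqxx.
have nxy : x != y by apply: contraTneq xy => ->; rewrite adj_irrefl.
have := hxy x; have := hxy y; rewrite !inE !eqxx orbT /=.
move=> /esym/orP[]/eqP ey /esym/orP[]/eqP ex; subst; rewrite ?eqxx in nxy *;
  by [|left|right].
Qed.

(** Eigenvectors are rows indexed by ordinals; symmetry of [adj] lets the equation be read as a sum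
    over the neighbours of each vertex. *)
Lemma adjmx_eigenvalueP (R : realType) (G : sgraph) (l : R) :
  eigenvalue (adjmx R G) l <->
  exists2 y : G -> R, exists x, y x != 0 &
    forall x, \sum_z (adj x z)%:R * y z = l * y x.
Proof.
split.
  move=> /eigenvalueP[v vA v0]; exists (fun x => v 0 (enum_rank x)).
    case/rV0Pn: v0 => i vi; exists (enum_val i); by rewrite enum_valK.
  move=> x; have /rowP/(_ (enum_rank x)) := vA; rewrite !mxE => <-.
  rewrite (reindex (@enum_rank G)) /=; last first.
    by exists enum_val => i _; rewrite ?enum_valK ?enum_rankK.
  by apply: eq_bigr => z _; rewrite mxE !enum_rankK adj_sym mulrC.
move=> [y [x yx] Ay]; apply/eigenvalueP.
exists (\row_i y (enum_val i)).
  apply/rowP => j; rewrite !mxE -Ay [RHS](reindex (fun i : 'I_#|G| => enum_val i)) /=; last first.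
    by exists enum_rank => i _; rewrite ?enum_valK ?enum_rankK.
  by apply: eq_bigr => i _; rewrite !mxE adj_sym mulrC.
by apply/rV0Pn; exists (enum_rank x); rewrite mxE enum_rankK.
Qed.

(** The triangle inequality applied to the equation of any eigenvector; [0 <= spectral_radius R G]
    allows the factor to enter the absolute value. *)
Lemma spectral_radius_subvector (R : realType) (G : sgraph) :
  (0 < #|G|)%N -> 0 <= spectral_radius R G ->
  exists (z : G -> R) (u : G),
  [/\ forall x, 0 <= z x <= 1, z u = 1 &
      forall x, spectral_radius R G * z x <= \sum_y (adj x y)%:R * z y].
Proof.
move=> G0 l0; have [/adjmx_eigenvalueP[y [x0 yx0] Ay] _] := spectral_radiusP R G0.
pose u := [arg max_(i > x0) `|y i|]%O.
have umax x : `|y x| <= `|y u| by rewrite /u; case: arg_maxP => // i _; apply.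
have yu : 0 < `|y u| by apply: lt_le_trans (umax x0); rewrite normr_gt0.
exists (fun x => `|y x| / `|y u|), u; split.
- by move=> x; rewrite divr_ge0 //= ler_pdivrMr ?mul1r.
- by rewrite divff // gt_eqF.
move=> x; under eq_bigr do rewrite mulrA.
rewrite mulrA -mulr_suml ler_pM2r ?invr_gt0 //.
rewrite -{1}(ger0_norm l0) -normrM -Ay; apply: le_trans (ler_norm_sum _ _ _) _.
by apply: ler_sum => z _; rewrite normrM normr_nat.
Qed.

(** * Splitting the graph around a vertex [u] *)

Definition nbhd (G : sgraph) (u : G) : {set G} := [set v | adj u v].
Definition far (G : sgraph) (u : G) : {set G} := ~: (u |: nbhd u).
Definition deg_in (G : sgraph) (D : {set G}) (v : G) : nat :=
  #|[set y in D | adj v y]|.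

Lemma big_nbhd_far (R : nmodType) (G : sgraph) (u : G) (F : G -> R) :
  \sum_x F x = F u + \sum_(x in nbhd u) F x + \sum_(x in far u) F x.
Proof.
rewrite (bigD1 u) //= -addrA; congr (_ + _).
rewrite (bigID (mem (nbhd u))) /=; congr (_ + _); apply: eq_bigl => x;
  rewrite !inE ?negb_or //.
by case: eqP => // ->; rewrite adj_irrefl.
Qed.

Lemma deg_in_sumE (R : pzSemiRingType) (G : sgraph) (D : {set G}) (v : G) :
  (deg_in D v)%:R = \sum_(y in D) (adj v y)%:R :> R.
Proof.
rewrite -natr_sum /deg_in -sum1_card big_mkcond [in RHS]big_mkcond /=.
congr (_%:R); apply: eq_bigr => y _; rewrite inE.
by case: (y \in D); case: adj.
Qed.

Lemma deg_in_gt0 (G : sgraph) (D : {set G}) (v y : G) :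
  y \in D -> adj v y -> (0 < deg_in D v)%N.
Proof. by move=> yD vy; apply/card_gt0P; exists y; rewrite inE yD. Qed.

Lemma deg_in_gt0P (G : sgraph) (D : {set G}) (v : G) :
  reflect (exists2 y, y \in D & adj v y) (0 < deg_in D v)%N.
Proof.
by apply: (iffP card_gt0P) => -[y]; rewrite ?inE;
  [case/andP; exists y | exists y; rewrite inE; apply/andP].
Qed.

(** If [y] differed from [t], two of the at least four neighbours of [t] in [nbhd u] would avoid [e]
    and [y]; call them a and b. The paths u-a-t, u-b-t and u-y-e-t then form the forbidden theta
    graph. *)
Lemma theta223_free_local (G : sgraph) (u t e y : G) :
  free_of (theta_graph 2 2 3) G -> t != u -> (4 <= deg_in (nbhd u) t)%N ->
  e \in nbhd u -> adj t e -> y \in nbhd u -> adj e y -> y = t.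
Proof.
move=> free tu dt eN te yN ey; apply/eqP/negPn/negP => yt.
pose S := [set x in nbhd u | adj t x] :\: [set e; y].
have /card_gt1P[a [b [aS bS ab]]] : (1 < #|S|)%N.
  rewrite cardsD; have : (#|[set x in nbhd u | adj t x] :&: [set e; y]| <= 2)%N.
    by apply: leq_trans (subset_leq_card (subsetIr _ _)) _; rewrite cards2; case: eqP.
  move: dt; rewrite /deg_in; lia.
have adj_neq (x x' : G) : adj x x' -> x != x'.
  by apply: contraTneq => ->; rewrite adj_irrefl.
move: aS bS eN yN; rewrite !inE !negb_or => /and3P[/andP[ae ay] ua ta].
move=> /and3P[/andP[be by_] ub tb] ue uy.
apply: (@theta223_free_path G u t a b y e) => //; try by rewrite adj_sym.
rewrite /= !inE !negb_or [u == t]eq_sym [t == y]eq_sym [y == e]eq_sym.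
by rewrite tu yt ab ae ay be by_ (adj_neq _ _ ua) (adj_neq _ _ ub)
  (adj_neq _ _ ue) (adj_neq _ _ uy) (adj_neq _ _ ta) (adj_neq _ _ tb)
  (adj_neq _ _ te) (adj_neq _ _ ey).
Qed.

(** Degree sum split into the contributions of [u], [nbhd u] and [far u]. Edges between the last two
    sets are counted from the [far u] side both times. *)
Lemma edges_nbhd_far (R : pzSemiRingType) (G : sgraph) (u : G) :
  (2 * #|edges G|)%:R = #|nbhd u|%:R + (#|nbhd u|%:R +
    \sum_(v in nbhd u) (deg_in (nbhd u) v)%:R +
    \sum_(w in far u) (deg_in (nbhd u) w)%:R) +
    (\sum_(w in far u) (deg_in (nbhd u) w)%:R +
     \sum_(w in far u) (deg_in (far u) w)%:R) :> R.
Proof.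
rewrite mul2n -sum_adj_edges natr_sum.
under eq_bigr do rewrite natr_sum (big_nbhd_far u) -!deg_in_sumE.
have degu : deg_in (nbhd u) u = #|nbhd u|.
  by apply: eq_card => y; rewrite !inE andbb.
have degfu : deg_in (far u) u = 0%N.
  by apply: eq_card0 => y; rewrite !inE negb_or -andbA; case: adj; rewrite ?andbF.
rewrite (big_nbhd_far u) !big_split /= adj_irrefl degu degfu add0r addr0.
congr (_ + (_ + _ + _) + _).
- rewrite -sum1_card natr_sum; apply: eq_bigr => v; by rewrite inE adj_sym => ->.
- under eq_bigr do rewrite deg_in_sumE.
  rewrite exchange_big /=; apply: eq_bigr => w _; rewrite deg_in_sumE.
  by apply: eq_bigr => v _; rewrite adj_sym.
- rewrite big1 ?add0r // => w; rewrite !inE negb_or adj_sym => /andP[_].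
  by case: adj.
Qed.

(* The graph is a book K_2 v r K_1 with spine {u, c}. *)
Definition book_spine (G : sgraph) (u c : G) : Prop :=
  c != u /\ forall x y : G,
    adj x y = (x != y) && ((x \in [set u; c]) || (y \in [set u; c])).

(** * Walks of length 2 from [u] *)

Section SubEigenvector.
Variables (R : realType) (G : sgraph) (u : G) (z : G -> R) (l : R).
Hypothesis free : free_of (theta_graph 2 2 3) G.
Hypothesis z01 : forall x, 0 <= z x <= 1.
Hypothesis zu : z u = 1.
Hypothesis Az : forall x, l * z x <= \sum_y (adj x y)%:R * z y.
Hypothesis l8 : 8 <= l.

Let N := nbhd u.
Let W := far u.
Let d (v : G) : R := (deg_in N v)%:R.
Let dW (v : G) : R := (deg_in W v)%:R.

Let z0 x : 0 <= z x. Proof. by case/andP: (z01 x). Qed.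
Let z1 x : z x <= 1. Proof. by case/andP: (z01 x). Qed.
Let a0 (x y : G) : 0 <= (adj x y)%:R :> R. Proof. exact: ler0n. Qed.
Let d0 v : 0 <= d v. Proof. exact: ler0n. Qed.
Let dW0 v : 0 <= dW v. Proof. exact: ler0n. Qed.

Let dE v : d v = \sum_(y in N) (adj y v)%:R.
Proof. by rewrite /d deg_in_sumE; apply: eq_bigr => y _; rewrite adj_sym. Qed.

Let du : d u = #|N|%:R.
Proof. by congr (_%:R); apply: eq_card => y; rewrite !inE andbb. Qed.

(** Total slack of A z >= l z over [N]. It is carried along, not dropped, because its vanishing in
    the tight case is what empties [C]. *)
Let excess : R := \sum_(v in N) (\sum_y (adj v y)%:R * z y - l * z v).

Let sum_N_ge : l <= \sum_(v in N) z v.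
Proof.
have := Az u; rewrite zu mulr1 => /le_trans; apply.
rewrite (big_nbhd_far u) adj_irrefl mul0r add0r.
rewrite [X in _ + X]big1 ?addr0; last first.
  by move=> w; rewrite !inE negb_or => /andP[_ /negPf->]; rewrite mul0r.
by apply: ler_sum => v; rewrite inE => ->; rewrite mul1r.
Qed.

(** Summing A z over [N] counts each z y with weight d y. With s the sum of z over [N], the two
    sides differ by exactly (l - 1)(s - l), nonnegative by [sum_N_ge]. *)
Let walk2_bound : l ^+ 2 - l + excess <=
  #|N|%:R + \sum_(v in N) (d v - 1) * z v + \sum_(w in W) d w * z w.
Proof.
pose s := \sum_(v in N) z v.
have -> : excess = #|N|%:R + \sum_(v in N) d v * z v + \sum_(w in W) d w * z w
                 - l * s.
  rewrite /excess sumrB -mulr_sumr; congr (_ - _); rewrite exchange_big /=.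
  have -> : #|N|%:R = d u * z u by rewrite du zu mulr1.
  rewrite /N /W -[RHS](big_nbhd_far u (fun v => d v * z v)).
  by apply: eq_bigr => y _; rewrite dE mulr_suml.
have -> : \sum_(v in N) (d v - 1) * z v = \sum_(v in N) d v * z v - s.
  by rewrite /s -sumrB; apply: eq_bigr => v _; rewrite mulrBl mul1r.
have : 0 <= (l - 1) * (s - l).
  by apply: mulr_ge0; rewrite subr_ge0 // (le_trans _ l8) // ler1n.
move: (\sum_(v in N) d v * z v) (\sum_(w in W) d w * z w) (#|N|%:R) => P Q K.
move: (s) (l) => s' l' h; lra.
Qed.

(** The neighbour [u] alone contributes 1 to A z at [v], and all other slacks are nonnegative. Thus
    zero excess forces z to be positive on [N]. *)
Let excess_term v : v \in N -> 1 - l * z v <= excess.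
Proof.
move=> vN; rewrite /excess (bigD1 v) //=.
have : 0 <= \sum_(i in N | i != v) (\sum_y (adj i y)%:R * z y - l * z i).
  by apply: sumr_ge0 => i _; rewrite subr_ge0 Az.
suff : 1 <= \sum_y (adj v y)%:R * z y by lra.
rewrite (bigD1 u) //= zu adj_sym; move: vN; rewrite inE => ->.
by rewrite mulr1 lerDl sumr_ge0 // => y _; rewrite mulr_ge0.
Qed.

Let excess_ge0 : 0 <= excess.
Proof. by apply: sumr_ge0 => i _; rewrite subr_ge0 Az. Qed.

Let far_bound w : w \in W -> l * z w <= d w + dW w.
Proof.
move=> wW; apply: le_trans (Az w) _.
rewrite (big_nbhd_far u) [adj w u]adj_sym.
have /negPf-> : ~~ adj u w by move: wW; rewrite !inE negb_or => /andP[].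
rewrite mul0r add0r /d /dW !deg_in_sumE.
by apply: lerD; apply: ler_sum => y _; rewrite ler_piMr.
Qed.

(* Centres of the big stars, their leaves, and the rest of N. *)
Let B := [set v in N | (4 <= deg_in N v)%N].
Let L := [set v in N | [exists b in B, adj v b]].
Let C := N :\: (B :|: L).

(** * Big stars and the remainder inside [N] *)

Let uNN v : v \in N -> v != u.
Proof. by apply: contraTneq => ->; rewrite inE adj_irrefl. Qed.

Let L_deg v : v \in L -> deg_in N v = 1%N.
Proof.
rewrite inE => /andP[vN /exists_inP[b]]; rewrite inE => /andP[bN b4] vb.
apply/eqP; rewrite eqn_leq (deg_in_gt0 bN vb) andbT -(cards1 b).
apply: subset_leq_card; apply/subsetP => y; rewrite inE => /andP[yN vy].
rewrite inE; apply/eqP.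
by apply: (theta223_free_local free (uNN bN) b4 vN _ yN vy); rewrite adj_sym.
Qed.

Let C_deg v : v \in C -> (deg_in N v <= 3)%N.
Proof.
by rewrite !in_setD !in_setU => /andP[+ vN]; rewrite negb_or inE vN /= -ltnNge
  => /andP[].
Qed.

Let C_sub v : v \in C -> v \in N. Proof. by rewrite in_setD => /andP[]. Qed.

(** A neighbour in [B] would make [v] a leaf; a neighbour in [L], attached to a centre b, would
    force v = b by [theta223_free_local]. *)
Let C_closed v y : v \in C -> y \in N -> adj v y -> y \in C.
Proof.
move=> vC yN vy; have vN := C_sub vC.
have vnB : v \notin B by rewrite inE vN -ltnNge ltnS C_deg.
have vnL : v \notin L by move: vC; rewrite in_setD in_setU negb_or => /andP[/andP[]].
rewrite in_setD yN andbT in_setU negb_or; apply/andP; split.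
  by apply: contra vnL => yB; rewrite inE vN; apply/exists_inP; exists y.
apply: contra vnB; rewrite inE => /andP[_ /exists_inP[b bB yb]].
move: (bB); rewrite inE => /andP[bN b4].
suff -> : v = b by [].
by apply: (theta223_free_local free (uNN bN) b4 yN _ vN); rewrite adj_sym.
Qed.

Let big_N (F : G -> R) :
  \sum_(v in N) F v = \sum_(v in B) F v + \sum_(v in L) F v + \sum_(v in C) F v.
Proof.
rewrite (big_setID (B :|: L)) /= -/C; congr (_ + _).
have -> : N :&: (B :|: L) = B :|: L.
  by apply/setIidPr/subsetP => v; rewrite !inE => /orP[]/andP[].
rewrite (eq_bigl (fun v => v \in [predU B & L])) ?bigU //=; last first.
  by move=> v; rewrite in_setU.
rewrite disjoint_sym disjoint_subset; apply/subsetP => v /L_deg dv.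
by rewrite !inE dv andbF.
Qed.

(** Double counting: every neighbour in [N] of a centre is a leaf, and a leaf, having degree 1 in
    [N], is counted at most once. *)
Let B_le_L : \sum_(b in B) d b <= #|L|%:R.
Proof.
under eq_bigr do rewrite dE.
rewrite exchange_big /= -sum1_card natr_sum [leRHS]big_mkcond /= big_mkcond /=.
apply: ler_sum => y _; case: ifP => yN; last by case: ifP.
case: ifP => yL.
  apply: (@le_trans _ _ (deg_in N y)%:R); last by rewrite L_deg.
  rewrite deg_in_sumE [leRHS]big_mkcond /= big_mkcond /=.
  by apply: ler_sum => b _; rewrite inE -/N; case: (b \in N) => //=; case: ifP.
rewrite big1 // => b bB; case yb: (adj y b) => //.
by move: yL; rewrite inE yN => /exists_inP[]; exists b.
Qed.

(** * Smallness of z on [C] and on the attached far vertices *)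

Let W1 := [set w in W | [exists v in C, adj v w && (0 < deg_in N v)%N]].

Let W_deg w v : w \in W -> v \in N -> adj v w -> (0 < deg_in N v)%N ->
  (deg_in N w <= 3)%N.
Proof.
move=> wW vN vw /deg_in_gt0P[y yN vy]; rewrite leqNgt; apply/negP => w4.
have wu : w != u by move: wW; rewrite !inE negb_or => /andP[].
have yw : y = w.
  by apply: (theta223_free_local free wu w4 vN _ yN vy); rewrite adj_sym.
by move: wW yN; rewrite yw !inE negb_or => /andP[_ /negPf->].
Qed.

Let W1_deg w : w \in W1 -> (deg_in N w <= 3)%N.
Proof.
rewrite inE => /andP[wW /exists_inP[v vC /andP[vw v0]]].
exact: (W_deg wW (C_sub vC) vw v0).
Qed.

Let W1_sub w : w \in W1 -> w \in W. Proof. by rewrite inE => /andP[]. Qed.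

(** Multiply A z >= l z at each [v] of [C] by d v <= 3 and sum. Neighbours in [N] stay in [C]; those
    in [W] lie in [W1] unless d v = 0, when the whole term vanishes. *)
Let C_bound : (l - 3) * (\sum_(v in C) d v * z v) <=
  \sum_(v in C) d v + 3 * \sum_(w in W1) d w * z w.
Proof.
have : l * (\sum_(v in C) d v * z v) <= \sum_(v in C) d v +
    3 * (\sum_(v in C) d v * z v) + 3 * \sum_(w in W1) d w * z w; last by lra.
have step v : v \in C -> l * (d v * z v) <= d v +
    3 * (\sum_(y in C) (adj v y)%:R * z y) +
    3 * \sum_(w in W1) (adj v w)%:R * z w.
  move=> vC; rewrite mulrCA; have dv3 : d v <= 3 by rewrite ler_nat C_deg.
  apply: le_trans (ler_wpM2l (d0 v) (Az v)) _.
  rewrite (big_nbhd_far u) zu adj_sym mulr1.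
  have -> : adj u v by have := C_sub vC; rewrite inE.
  rewrite !mulrDr mulr1 -!addrA lerD2l; apply: lerD.
    have -> : \sum_(x in nbhd u) (adj v x)%:R * z x
            = \sum_(y in C) (adj v y)%:R * z y.
      rewrite big_mkcond [RHS]big_mkcond /=; apply: eq_bigr => y _.
      case: ifP => yN; last by rewrite ifN //; apply: contraFN yN => /C_sub.
      case: ifP => // yC; case vy: (adj v y); last by rewrite mul0r.
      by rewrite (C_closed vC yN vy) in yC.
    apply: ler_wpM2r => //; apply: sumr_ge0 => y _; exact: mulr_ge0.
  have [dv0|dvp] := posnP (deg_in N v).
    rewrite /d dv0 mul0r mulr_ge0 // sumr_ge0 // => w _; exact: mulr_ge0.
  have -> : \sum_(x in far u) (adj v x)%:R * z x
          = \sum_(w in W1) (adj v w)%:R * z w.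
    rewrite big_mkcond [RHS]big_mkcond /=; apply: eq_bigr => y _.
    case: ifP => yW; last by rewrite ifN //; apply: contraFN yW => /W1_sub.
    case: ifP => // yW1; case vy: (adj v y); last by rewrite mul0r.
    by move: yW1; rewrite inE yW => /exists_inP[]; exists v => //; rewrite vy.
  apply: ler_wpM2r => //; apply: sumr_ge0 => y _; exact: mulr_ge0.
rewrite mulr_sumr; apply: le_trans (ler_sum _ step) _.
rewrite !big_split /= -!mulr_sumr -!addrA lerD2l.
have C_N (D : {set G}) : \sum_(v in C) \sum_(y in D) (adj v y)%:R * z y
    <= \sum_(y in D) d y * z y.
  rewrite exchange_big /=; apply: ler_sum => y _; rewrite dE mulr_suml.
  rewrite big_mkcond [leRHS]big_mkcond /=; apply: ler_sum => v _.
  case: ifP => [/C_sub->//|_]; case: ifP => // _; exact: mulr_ge0.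
by apply: lerD; rewrite ler_pM2l.
Qed.

Let W1_bound : l * (\sum_(w in W1) d w * z w) <=
  3 * (\sum_(w in W1) d w) + 3 * (\sum_(w in W) dW w).
Proof.
apply: (@le_trans _ _ (\sum_(w in W1) (3 * d w + 3 * dW w))).
  rewrite mulr_sumr; apply: ler_sum => w wW1; rewrite mulrCA.
  apply: le_trans (ler_wpM2l (d0 w) (far_bound (W1_sub wW1))) _.
  have : d w <= 3 by rewrite ler_nat W1_deg.
  by move=> dw3; rewrite -mulrDr ler_wpM2r // addr_ge0.
rewrite big_split /= -!mulr_sumr lerD2l ler_pM2l //.
rewrite big_mkcond [leRHS]big_mkcond /=; apply: ler_sum => w _.
by case: ifP => [/W1_sub->//|_]; case: ifP.
Qed.

(** * The combined inequality and its tight case *)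

Let m : R := #|edges G|%:R.

(** Subtract the edge count from [walk2_bound]. A centre contributes d/2 - (d - 1) z = (d - 1)(1 -
    z) + 1 - d/2 and a leaf 1/2; by [B_le_L] the leaves pay for the -d/2, leaving [#|B|]. *)
Let deficit : l ^+ 2 - l - (m - 1) + excess +
    ((\sum_(v in C) d v) / 2 - \sum_(v in C) d v * z v + \sum_(v in C) z v) +
    #|B|%:R + \sum_(v in B) (d v - 1) * (1 - z v) +
    \sum_(w in W) d w * (1 - z w) + (\sum_(w in W) dW w) / 2 <= 1.
Proof.
have mE := edges_nbhd_far R u; rewrite natrM -/m -/N -/W -/d -/dW in mE.
have sum1z (D : {set G}) : \sum_(v in D) d v * (1 - z v) =
    \sum_(v in D) d v - \sum_(v in D) d v * z v.
  by rewrite -sumrB; apply: eq_bigr => v _; rewrite mulrBr mulr1.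
have dz (D : {set G}) : \sum_(v in D) (d v - 1) * z v =
    \sum_(v in D) d v * z v - \sum_(v in D) z v.
  by rewrite -sumrB; apply: eq_bigr => v _; rewrite mulrBl mul1r.
have B1 : \sum_(v in B) (d v - 1) * (1 - z v) = \sum_(v in B) d v -
    \sum_(v in B) d v * z v - #|B|%:R + \sum_(v in B) z v.
  rewrite -sum1_card natr_sum -!sumrB -big_split /=; apply: eq_bigr => v _.
  by rewrite mulr1n; ring.
have L1 : \sum_(v in L) d v = #|L|%:R.
  by rewrite -sum1_card natr_sum; apply: eq_bigr => v vL; rewrite /d L_deg.
have L2 : \sum_(v in L) d v * z v = \sum_(v in L) z v.
  by apply: eq_bigr => v vL; rewrite /d L_deg // mul1r.
have := walk2_bound; have := B_le_L; rewrite B1 dz sum1z.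
move: mE; rewrite !big_N L1 L2.
move: (\sum_(v in B) d v) (\sum_(v in B) d v * z v) (\sum_(v in B) z v)
 (#|L|%:R : R) (\sum_(v in L) z v) (\sum_(v in C) d v) (\sum_(v in C) d v * z v)
 (\sum_(v in C) z v) (\sum_(w in W) d w) (\sum_(w in W) d w * z w)
 (\sum_(w in W) dW w) (#|B|%:R : R) (#|N|%:R : R) (excess) (m) (l ^+ 2) (l).
by move=> *; lra.
Qed.

Let C_gain : 0 <= (\sum_(v in C) d v) / 2 - \sum_(v in C) d v * z v +
  \sum_(w in W) d w * (1 - z w) + (\sum_(w in W) dW w) / 2.
Proof.
pose Y := \sum_(v in C) d v * z v; pose S := \sum_(w in W1) d w * z w.
have Y0 : 0 <= Y by apply: sumr_ge0 => v _; exact: mulr_ge0.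
have S0 : 0 <= S by apply: sumr_ge0 => v _; exact: mulr_ge0.
have e0 : 0 <= \sum_(v in C) d v by exact: sumr_ge0.
have dz0 w : 0 <= d w * (1 - z w) by rewrite mulr_ge0 // subr_ge0.
have SE : \sum_(w in W1) d w - S = \sum_(w in W1) d w * (1 - z w).
  by rewrite -sumrB; apply: eq_bigr => w _; rewrite mulrBr mulr1.
have E0 : S <= \sum_(w in W1) d w by rewrite -subr_ge0 SE sumr_ge0.
have : \sum_(w in W1) d w - S <= \sum_(w in W) d w * (1 - z w).
  rewrite SE big_mkcond [leRHS]big_mkcond /=; apply: ler_sum => w _.
  by case: ifP => [/W1_sub->//|_]; case: ifP.
have h1 : 8 * S <= 3 * (\sum_(w in W1) d w) + 3 * (\sum_(w in W) dW w).
  by apply: le_trans W1_bound; apply: ler_wpM2r.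
have h2 : (8 - 3) * Y <= \sum_(v in C) d v + 3 * S.
  by apply: le_trans C_bound; apply: ler_wpM2r => //; rewrite lerD2r.
(* Let e, E and D be the sums of d over [C], of d over [W1] and of dW over [W]. Then h1/6 and E0/2
   give E + D/2 >= 11 S/6, and h2 gives Y <= e/5 + 3 S/5. As the sum of d (1 - z) over [W] is at
   least E - S, the total is at least 3 e/10 + 7 S/30. *)
move: Y0 S0 e0 E0 h1 h2; rewrite -/Y.
move: (Y) (S) (\sum_(v in C) d v) (\sum_(w in W1) d w) (\sum_(w in W) dW w)
  (\sum_(w in W) d w * (1 - z w)) => *; lra.
Qed.

Lemma extremal_structure : no_isolated_vertex G ->
  #|edges G|%:R - 1 <= l ^+ 2 - l ->
  l ^+ 2 - l = #|edges G|%:R - 1 /\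
  exists c, book_spine u c.
Proof.
move=> noiso ml; rewrite -/m in ml *.
have zC0 : 0 <= \sum_(v in C) z v by exact: sumr_ge0.
have dzB v : v \in B -> 0 <= (d v - 1) * (1 - z v).
  rewrite inE => /andP[_ v4]; rewrite mulr_ge0 ?subr_ge0 // ler1n.
  exact: leq_trans v4.
have zB0 : 0 <= \sum_(v in B) (d v - 1) * (1 - z v) by exact: sumr_ge0.
have tot : l ^+ 2 - l - (m - 1) + excess + \sum_(v in C) z v + #|B|%:R +
    \sum_(v in B) (d v - 1) * (1 - z v) <= 1.
  have := deficit; have := C_gain.
  move: (\sum_(v in C) d v) (\sum_(v in C) d v * z v)
   (\sum_(w in W) dW w) (\sum_(w in W) d w * (1 - z w)) (\sum_(v in C) z v)
   (\sum_(v in B) (d v - 1) * (1 - z v)) (#|B|%:R : R) (excess) (l ^+ 2) (l) (m).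
  by move=> *; lra.
have [B0|/set0Pn[c cB]] := eqVneq B set0.
  (* Without big stars, [sum_N_ge] puts at least l >= 8 into a total bounded by 1. *)
  exfalso; have CN : C = N.
    apply/setP => v; rewrite in_setD in_setU B0 in_set0 /= [v \in L]inE B0.
    case: existsP => [[b]|_]; rewrite ?in_set0 ?andbF ?andbT //.
  move: tot; rewrite CN B0 cards0 big_set0; have := sum_N_ge.
  move: excess_ge0 ml l8.
  move: (excess) (\sum_(v in N) z v) (l ^+ 2) (l) (m) => *; lra.
have B1 : (1 <= #|B|)%N by apply/card_gt0P; exists c.
(* One big star already exhausts the bound 1 in [tot], so all other nonnegative terms vanish. *)
have [lE exc0 zC B1' zB] : [/\ l ^+ 2 - l = m - 1, excess = 0,
    \sum_(v in C) z v = 0, (#|B|%:R : R) <= 1 &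
    \sum_(v in B) (d v - 1) * (1 - z v) = 0].
  move: B1; rewrite -(ler1n R); move: zC0 zB0 tot excess_ge0 ml.
  move: (\sum_(v in C) z v) (\sum_(v in B) (d v - 1) * (1 - z v))
    (#|B|%:R : R) (excess) (l ^+ 2) (l) (m) => *; split; lra.
have BE v : (v \in B) = (v == c).
  rewrite lern1 in B1'; have /cards1P[b Bb] : #|B| == 1%N by rewrite eqn_leq B1'.
  by move: cB; rewrite Bb !inE => /eqP->.
have C0 : C = set0.
  apply/setP => v; rewrite in_set0; apply/negP => vC.
  have := excess_term (C_sub vC); rewrite exc0.
  suff -> : z v = 0 by rewrite mulr0 subr0 ler10.
  by apply/eqP; move: zC => /eqP; rewrite psumr_eq0 // => /allP/(_ v);
    rewrite mem_index_enum vC => /(_ isT).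
have NE v : v \in N -> v = c \/ v \in L.
  move=> vN; have : v \notin C by rewrite C0 inE.
  rewrite in_setD vN andbT negbK in_setU BE => /orP[/eqP|]; by [left|right].
have cN : c \in N by move: cB; rewrite inE => /andP[].
have c4 : (4 <= deg_in N c)%N by move: cB; rewrite inE => /andP[].
have Lc v : v \in L -> adj v c.
  by rewrite inE => /andP[_ /exists_inP[b]]; rewrite BE => /eqP->.
(* A far vertex w would have all its neighbours in [N]. Each of these has a neighbour in [N], so d w
   <= 3; since d w (1 - z w) = 0 and d w > 0, z w = 1, and [far_bound] gives l <= 3. *)
have W0 w : w \notin W.
  apply/negP => wW.
  have sumW0 : 0 <= \sum_(w in W) dW w by exact: sumr_ge0.
  have dz0 x : 0 <= d x * (1 - z x) by rewrite mulr_ge0 // subr_ge0.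
  have sumdz0 : 0 <= \sum_(w in W) d w * (1 - z w) by exact: sumr_ge0.
  have [dz dw] : \sum_(w in W) d w * (1 - z w) = 0 /\ \sum_(w in W) dW w = 0.
    have := deficit; rewrite C0 !big_set0 exc0 zB lE.
    move: B1; rewrite -(ler1n R); move: sumW0 sumdz0.
    move: (\sum_(w in W) dW w) (\sum_(w in W) d w * (1 - z w)) (#|B|%:R : R) (m).
    by move=> *; split; lra.
  have dWw : dW w = 0.
    apply/eqP; move: dw => /eqP; rewrite psumr_eq0 // => /allP/(_ w).
    by rewrite mem_index_enum wW => /(_ isT).
  have : d w * (1 - z w) = 0.
    apply/eqP; move: dz => /eqP; rewrite psumr_eq0 // => /allP/(_ w).
    by rewrite mem_index_enum wW => /(_ isT).
  have [y wy] := noiso w.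
  have yN : y \in N.
    have yW : y \notin W.
      apply/negP => yW; move: dWw; apply/eqP; rewrite pnatr_eq0 -lt0n.
      exact: deg_in_gt0 yW wy.
    move: yW; rewrite !inE negbK => /orP[/eqP yu|//].
    by move: wW wy; rewrite yu !inE adj_sym negb_or => /andP[_ /negPf->].
  have dy : (0 < deg_in N y)%N.
    by case: (NE y yN) => [->|/L_deg->//]; apply: leq_trans c4.
  have dw3 : d w <= 3 by rewrite ler_nat (W_deg wW yN) // adj_sym.
  have dwp : d w != 0 by rewrite pnatr_eq0 -lt0n (deg_in_gt0 yN wy).
  move=> /eqP; rewrite mulf_eq0 (negPf dwp) /= subr_eq0 => /eqP zw.
  have := far_bound wW; rewrite -zw dWw mulr1 addr0; move: dw3 l8.
  by move: (d w) (l) => *; lra.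
have VE v : [\/ v = u, v = c | v \in L].
  have : v \notin W by apply: W0.
  rewrite in_setC negbK in_setU1 => /orP[/eqP->|/NE[->|vL]];
    by [constructor 1|constructor 2|constructor 3].
have LN v : v \in L -> v \in N by rewrite inE => /andP[].
have Lneu v : v \in L -> (v == u) = false by move/LN/uNN/negPf.
have Lnec v : v \in L -> (v == c) = false.
  by move=> vL; apply/eqP => vc; move: c4; rewrite -vc L_deg.
have cu := uNN cN; have uc : adj u c by move: cN; rewrite inE.
have uL v : v \in L -> adj u v by move/LN; rewrite inE.
split=> //; exists c; split=> // x y; rewrite !inE.
case: (VE x) => [->|->|xL]; case: (VE y) => [->|->|yL];
  rewrite ?eqxx ?adj_irrefl ?(negPf cu) ?orbT /= ?[u == _]eq_sym ?[c == _]eq_sym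
    ?(Lneu _ xL) ?(Lnec _ xL) ?(Lneu _ yL) ?(Lnec _ yL) ?(negPf cu) /=;
  rewrite ?uc ?[adj c u]adj_sym ?uc ?uL // ?[adj c _]adj_sym ?[adj _ u]adj_sym
    ?Lc ?uL //.
  by rewrite eq_sym cu.
(* Two adjacent leaves would contradict [theta223_free_local] at the centre [c]. *)
rewrite andbF; apply/negbTE/negP => xy.
have := theta223_free_local free cu c4 (LN _ xL) _ (LN _ yL) xy.
by rewrite adj_sym => /(_ (Lc _ xL))/eqP; rewrite Lnec.
Qed.

End SubEigenvector.

(** * Book graphs: size, isomorphism type and an eigenvalue *)

Lemma card_neq2 (T : finType) (u c : T) :
  u != c -> #|[pred x | (x != u) && (x != c)]| = (#|T| - 2)%N.
Proof.
move=> uc; rewrite -(cardC (pred2 u c)) card2 uc addKn.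
by apply: eq_card => x; rewrite !inE negb_or.
Qed.

Lemma book_card_edges (G : sgraph) (u c : G) :
  book_spine u c -> #|edges G| = (2 * (#|G| - 2)).+1.
Proof.
move=> [cu adjE].
have G2 : (2 <= #|G|)%N by rewrite (cardD1 u) (cardD1 c) !inE cu.
have spine x : x \in [set u; c] -> (\sum_y adj x y = #|G|.-1)%N.
  move=> xS; rewrite -(cardC1 x) -sum1_card big_mkcond [RHS]big_mkcond /=.
  by apply: eq_bigr => y _; rewrite adjE xS andbT inE eq_sym.
have := sum_adj_edges G.
rewrite (bigD1 u) //= spine ?inE ?eqxx // (bigD1 c) //= spine ?inE ?eqxx ?orbT //.
rewrite (eq_bigr (fun=> 2%N)); last first.
  move=> x /andP[xu xc]; rewrite (bigD1 u) //= (bigD1 c) //= big1 => [|y].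
    by rewrite !adjE xu xc !inE !eqxx !orbT.
  by move=> /andP[/negPf yu /negPf yc];
    rewrite adjE !inE yu yc (negPf xu) (negPf xc) andbF.
rewrite sum_nat_const card_neq2 1?eq_sym //; set k := #|G| in G2 *; lia.
Qed.

(** In both graphs, adjacency means being distinct with at least one vertex on the spine, so a
    bijection matching the spines is an isomorphism. *)
Lemma book_isomorphicP (G : sgraph) (r : nat) :
  isomorphic G (graph_join (complete_graph 2) (edgeless_graph r)) <->
  #|G| = r.+2 /\ exists u c : G, book_spine u c.
Proof.
set H := graph_join _ _.
have HE (x y : H) : adj x y =
    (x != y) && ((if x is inl _ then true else false) || (if y is inl _ then true else false)).
  by case: x y => [i|i] [j|j] //=; rewrite /sym_adj /= ?andbT ?andbF.
have cardH : #|H| = r.+2 by rewrite card_sum !card_ord.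
split.
  move=> [f [g fK gK] fE]; split.
    by rewrite -cardH; apply: (bij_eq_card (f := f)); exists g.
  exists (g (inl ord0)), (g (inl ord_max)); split.
    by rewrite (can_eq gK).
  move=> x y; rewrite -fE HE (can_eq fK); congr (_ && _).
  have spine v : (if f v is inl _ then true else false) =
      (v \in [set g (inl ord0); g (inl ord_max)]).
    rewrite !inE -!(can2_eq fK gK); case: (f v) => // -[[|[|i]] ilt] //.
  by rewrite !spine.
move=> [cG [u [c [cu adjE]]]].
pose S := ~: [set u; c].
have cS : #|S| = r.
  by have := cardsC [set u; c]; rewrite cards2 eq_sym cu cG => -[].
pose g (x : H) : G := match x with
  | inl i => if i == ord0 then u else c
  | inr j => enum_val (cast_ord (esym cS) j) end.
have gS x : (g x \in [set u; c]) = if x is inl _ then true else false.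
  case: x => [i|j] /=; first by case: ifP; rewrite !inE eqxx ?orbT.
  by have := enum_valP (cast_ord (esym cS) j); rewrite in_setC => /negbTE.
have ginj : injective g.
  move=> x y gxy; have := gS x; have := gS y; rewrite gxy => ->.
  case: x y gxy => [i|i] [j|j] //= gxy _; last first.
    by congr inr; move: gxy => /enum_val_inj/cast_ord_inj.
  congr inl; move: gxy; case: i j => [[|[|i]] ilt] [[|[|j]] jlt] //= h;
    by [apply: val_inj | move: cu; rewrite h eqxx].
have [f gK fK] : bijective g by apply: inj_card_bij => //; rewrite cardH cG.
exists f; first by exists g.
move=> x y; rewrite -{2}[x]fK -{2}[y]fK HE adjE (inj_eq ginj) !gS.
by [].
Qed.

Lemma book_eigenvalue (R : realType) (G : sgraph) (u c : G) (mu : R) :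
  book_spine u c -> mu != 0 -> mu ^+ 2 - mu = (2 * (#|G| - 2))%:R ->
  eigenvalue (adjmx R G) mu.
Proof.
move=> [cu adjE] mu0 muE; apply/adjmx_eigenvalueP.
have uc : u != c by rewrite eq_sym.
(* Off the spine the equation reads 2 mu = mu * 2; on it, mu + 2 (n - 2) = mu^2, with n the number
   of vertices. *)
exists (fun x => if x \in [set u; c] then mu else 2).
  by exists u; rewrite !inE eqxx.
have rest (F : G -> R) (k : R) : (forall y, y \notin [set u; c] -> F y = k) ->
    \sum_y F y = F u + F c + (#|G| - 2)%:R * k.
  move=> Fk; rewrite (bigD1 u) //= (bigD1 c) //= addrA; congr (_ + _).
  rewrite (eq_bigr (fun=> k)); last first.
    by move=> y /andP[yu yc]; apply: Fk; rewrite !inE negb_or yu.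
  by rewrite sumr_const mulr_natl card_neq2.
move=> x; have [xS|xS] := boolP (x \in [set u; c]); last first.
  rewrite (rest _ 0) => [|y yS]; last by rewrite adjE (negPf xS) (negPf yS) andbF mul0r.
  move: (xS); rewrite !inE negb_or => /andP[xu xc].
  by rewrite !adjE xu xc !inE !eqxx !orbT /=; ring.
rewrite (rest _ 2) => [|y yS]; last first.
  rewrite adjE xS (negPf yS) andbT.
  have -> : x != y by apply: contraNneq yS => <-.
  by rewrite mul1r.
rewrite !adjE xS !andbT !inE !eqxx orbT; rewrite natrM in muE.
move: xS; rewrite !inE => /orP[]/eqP->; rewrite eqxx ?uc ?cu /=; lra.
Qed.

(** * Comparison of the spectral radius with the root [mu] of x^2 - x = m - 1 *)

Theorem theorem1p2 (R : realType) (m : nat) (G : sgraph) :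
  (57 <= m)%N ->
  free_of (theta_graph 2 2 3) G ->
  #|edges G| = m ->
  no_isolated_vertex G ->
  spectral_radius R G <= (1 + Num.sqrt (4 * m%:R - 3)) / 2 /\
  (spectral_radius R G = (1 + Num.sqrt (4 * m%:R - 3)) / 2 <->
   odd m /\
   isomorphic G (graph_join (complete_graph 2) (edgeless_graph (m.-1)./2))).
Proof.
move=> m57 free mE noiso.
pose s : R := Num.sqrt (4 * m%:R - 3); rewrite -/s.
have mR : (57 : R) <= m%:R by rewrite ler_nat.
have s2 : s ^+ 2 = 4 * m%:R - 3 by rewrite sqr_sqrtr //; lra.
(* Here 57 enters: 4 * 57 - 3 = 15^2, which gives [mu >= 8]. *)
have s15 : 15 <= s.
  rewrite -(@ler_pXn2r _ 2) ?nnegrE ?sqrtr_ge0 // s2; lra.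
have G0 : (0 < #|G|)%N.
  apply/card_gt0P; have /card_gt0P[E] : (0 < #|edges G|)%N by rewrite mE (leq_trans _ m57).
  by case/imsetP=> -[x y] _ _; exists x.
pose mu := (1 + s) / 2; rewrite -/mu.
have muE : mu ^+ 2 - mu = m%:R - 1 by rewrite /mu; lra.
have mu8 : 8 <= mu by rewrite /mu; lra.
set l := spectral_radius R G.
(* This serves twice: it excludes [mu < l], and it yields the book structure when [l = mu]. *)
have key : mu <= l -> l = mu /\ exists u c : G, book_spine u c.
  move=> lmu; have l8 : 8 <= l by apply: le_trans lmu.
  have [|z [u [z01 zu Az]]] := spectral_radius_subvector (R := R) G0.
    by apply: le_trans l8.
  have [|lE [c spine]] := extremal_structure free z01 zu Az l8 noiso.
    rewrite mE -muE -!/l; nra.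
  split; last by exists u, c.
  have : (l - mu) * (l + mu - 1) = 0 by move: lE muE; rewrite mE -/l; lra.
  by move/eqP; rewrite mulf_eq0 => /orP[]/eqP; lra.
have lmu : l <= mu.
  rewrite leNgt; apply/negP => lt; have [lE _] := key (ltW lt).
  by rewrite lE ltxx in lt.
split=> //; split.
  move=> lE; have [|_ [u [c spine]]] := key; first by rewrite lE.
  have := book_card_edges spine; rewrite mE => mG.
  have G2 : (2 <= #|G|)%N by case: spine => cu _; rewrite (cardD1 u) (cardD1 c) !inE cu.
  split; first by rewrite mG /= mul2n odd_double.
  apply/book_isomorphicP; split; last by exists u, c.
  by rewrite mG /= mul2n doubleK; set k := #|G| in G2 *; lia.
move=> [_ /book_isomorphicP[cG [u [c spine]]]].
apply/le_anti; rewrite lmu /=; apply: (proj2 (spectral_radiusP R G0)).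
apply: (book_eigenvalue spine); first by rewrite gt_eqF // (lt_le_trans _ mu8).
have := book_card_edges spine; rewrite mE => mG.
by rewrite muE mG -natr1 addrK.
Qed.
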